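(* Let $R$ be an evenly graded commutative ring and let $d$ be an even integer. The $R$-universal even Moore algebra of degree $d$, i.e. the even Moore algebra over $R[u_1,u_2,\ldots]$ (with $|u_i|=i(d+2)-2$ and augmentation $u_i\mapsto 0$) with $A_\infty$-structure $$\sum_{i=1}^\infty u_it^i\partial_\tau+ad\tau-\tau^2\partial_\tau,$$ is a miniversal deformation of the trivial even Moore algebra $A:=R[X]/X^2$ of degree $d$, i.e. of the even Moore algebra over $R$ with $A_\infty$-structure $ad\tau-\tau^2\partial_\tau$.
   Context: Evenly graded means concentrated in even degrees. For an evenly graded commutative ring $\Lambda$, $\Lambda[[\tau,t]]$ denotes the graded $\Lambda$-algebra of formal power series in two non-commuting variables with $|\tau|=-1$, $|t|=-(d+2)$ (elements of $\Lambda$ are central), with its natural topology. All derivations are graded derivations; $A\,\partial_\tau+B\,\partial_t$ denotes the continuous derivation with $\tau\mapsto A$, $t\mapsto B$; $ad\tau(x)=[\tau,x]$ is the graded commutator. An even Moore algebra of degree $d$ over $\Lambda$ is a unital $A_\infty$-structure on the free graded module $\Sigma^{d+1}\Lambda\oplus\Lambda$ ($d$ even); it is a continuous derivation of $\Lambda[[\tau,t]]$ of degree $-1$ of the form $\sum_{i\ge1}\lambda_it^i\partial_\tau+ad\tau-\tau^2\partial_\tau$ with $\lambda_i\in\Lambda$, $|\lambda_i|=i(d+2)-2$ (its square is automatically zero). Deformations. Let $A$ be a Moore algebra over $R$ with structure $m$. Let $(\Lambda,\varepsilon)$ be an evenly graded unital commutative $R$-algebra with an augmentation $\varepsilon:\Lambda\to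 R$ (a homomorphism of $R$-algebras), extended coefficientwise to $\varepsilon:\Lambda[[\tau,t]]\to R[[\tau,t]]$. A deformation of $A$ with base $(\Lambda,\varepsilon)$ is a unital $\Lambda$-linear $A_\infty$-structure $\bar m$ on $\Lambda\otimes_RA$ (a Moore algebra over $\Lambda$) with $\varepsilon\bar m=m\varepsilon$. Two deformations $\bar m_1,\bar m_2$ with the same base are equivalent if there is a continuous automorphism $\phi$ of the $\Lambda$-algebra $\Lambda[[\tau,t]]$, of degree $0$, with $\phi\bar m_1=\bar m_2\phi$ and $\varepsilon\phi=\varepsilon$; as throughout, only unital isomorphisms are considered, i.e. $\phi$ has the form $\tau\mapsto\tau+G(t)$, $t\mapsto F(t)$ with $G,F\in\Lambda[[t]]$ having vanishing constant terms and $F$ having invertible coefficient at $t$. A homomorphism of augmented (graded) $R$-algebras $f:(\Lambda,\varepsilon)\to(\Lambda',\varepsilon')$ is a unital $R$-algebra homomorphism with $\varepsilon'f=\varepsilon$; the push-out $f_*\bar m$ of a deformation $\bar m$ with base $\Lambda$ is the deformation with base $\Lambda'$ obtained by applying $f$ to the coefficients, i.e. $f_*\bar m=(f\bar m(\tau))\partial_\tau+(f\bar m(t))\partial_t$. A deformation $\bar m_\Lambda$ of $A$ with base $(\Lambda,\varepsilon)$ is versal if for any deformation $\bar m_{\Lambda'}$ of $A$ with any base $(\Lambda',\varepsilon')$ there is a homomorphism of augmented $R$-algebras $f:\Lambda\to\Lambda'$ such that $f_*\bar m_\Lambda$ is equivalent to $\bar m_{\Lambda'}$. A deformation with base $(\Lambda',\varepsilon')$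 is infinitesimal if $\ker(\varepsilon')^2=0$. A versal deformation $\bar m_\Lambda$ is miniversal if this $f$ is unique for every infinitesimal deformation of $A$. *)

(* Defs.v *)
From HB Require Import structures.
From mathcomp Require Import all_boot all_order all_algebra.
From mathcomp Require Import boolp.
From mathcomp Require Import finmap monalg.
From mathcomp Require Import ring zify.

Set Implicit Arguments.
Unset Strict Implicit.
Unset Printing Implicit Defensive.

Import Order.TTheory GRing.Theory Num.Theory.
Local Open Scope ring_scope.

(* [dg n x] reads "x is homogeneous of degree n".  The fields [egr_gen] and
   [egr_indep] say that the ring is the internal direct sum of its homogeneous
   components. *)
Record even_grading (R : comNzRingType) (dg : int -> R -> Prop) : Prop := {
  egr0 : forall n, dg n 0;
  egrB : forall n x y, dg n x -> dg n y -> dg n (x - y);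
  egr1 : dg 0 1;
  egrM : forall m n x y, dg m x -> dg n y -> dg (m + n) (x * y);
  egr_gen : forall x, exists s : seq (int * R),
    (forall p, p \in s -> dg p.1 p.2) /\ x = \sum_(p <- s) p.2;
  egr_indep : forall (s : seq int) (f : int -> R),
    uniq s -> (forall n, dg n (f n)) -> \sum_(n <- s) f n = 0 ->
    forall n, n \in s -> f n = 0;
  egr_even : forall n x, dg n x -> ~~ (2 %| n)%Z -> x = 0
}.

Variant letter := Tau | Te.

Definition is_tau (a : letter) := if a is Tau then true else false.

Notation word := (seq letter).

Definition series (L : comNzRingType) := word -> L.

Section SeriesAlgebra.
Variable L : comNzRingType.
Implicit Types x y z : series L.

HB.instance Definition _ := gen_eqMixin (series L).
HB.instance Definition _ := gen_choiceMixin (series L).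

Definition ser_zero : series L := fun _ => 0.
Definition ser_opp x : series L := fun w => - x w.
Definition ser_add x y : series L := fun w => x w + y w.
Definition ser_scale (c : L) x : series L := fun w => c * x w.
Definition ser_one : series L := fun w => (nilp w)%:R.
Definition ser_mul x y : series L := fun w =>
  \sum_(i < (size w).+1) x (take i w) * y (drop i w).

Definition lshift (p : word) x : series L := fun w => x (p ++ w).

Fact ser_addA : associative ser_add.
Proof. by move=> x y z; apply/funext=> w; apply: addrA. Qed.
Fact ser_addC : commutative ser_add.
Proof. by move=> x y; apply/funext=> w; apply: addrC. Qed.
Fact ser_add0 : left_id ser_zero ser_add.
Proof. by move=> x; apply/funext=> w; apply: add0r. Qed.
Fact ser_addN : left_inverse ser_zero ser_opp ser_add.
Proof. by move=> x; apply/funext=> w; apply: addNr. Qed.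

HB.instance Definition _ :=
  GRing.isZmodule.Build (series L) ser_addA ser_addC ser_add0 ser_addN.

Fact ser_mul_nil x y : ser_mul x y [::] = x [::] * y [::].
Proof. by rewrite /ser_mul big_ord_recl big_ord0 addr0. Qed.

Fact ser_mul_cons x y a w :
  ser_mul x y (a :: w) = x [::] * y (a :: w) + ser_mul (lshift [:: a] x) y w.
Proof. by rewrite /ser_mul big_ord_recl. Qed.

Fact ser_mulDl : left_distributive ser_mul +%R.
Proof.
move=> x y z; apply/funext=> w; rewrite -[RHS]big_split.
by apply: eq_bigr => i _; rewrite mulrDl.
Qed.
Fact ser_mulDr : right_distributive ser_mul +%R.
Proof.
move=> x y z; apply/funext=> w; rewrite -[RHS]big_split.
by apply: eq_bigr => i _; rewrite mulrDr.
Qed.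
Fact ser_scaleAl c x y : ser_scale c (ser_mul x y) = ser_mul (ser_scale c x) y.
Proof.
apply/funext=> w; rewrite /ser_scale mulr_sumr.
by apply: eq_bigr => i _; rewrite mulrA.
Qed.
Fact ser_scaleAr c x y : ser_scale c (ser_mul x y) = ser_mul x (ser_scale c y).
Proof.
apply/funext=> w; rewrite /ser_scale mulr_sumr.
by apply: eq_bigr => i _; rewrite mulrCA.
Qed.

Fact lshift_mul a x y : lshift [:: a] (ser_mul x y) =
  ser_scale (x [::]) (lshift [:: a] y) + ser_mul (lshift [:: a] x) y.
Proof. by apply/funext=> w; rewrite [LHS]ser_mul_cons. Qed.

Fact ser_mulA : associative ser_mul.
Proof.
move=> x y z; apply/funext=> w; elim: w x y z => [|a w IHw] x y z.
  by rewrite !ser_mul_nil mulrA.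
rewrite !ser_mul_cons ser_mul_nil lshift_mul ser_mulDl mulrDr -addrA mulrA.
by rewrite -ser_scaleAl IHw.
Qed.
Fact ser_mul1 : left_id ser_one ser_mul.
Proof.
move=> x; apply/funext=> w; rewrite /ser_mul big_ord_recl /ser_one /=.
rewrite take0 drop0 mul1r big1 ?addr0 // => i _.
by case: w i => [|a w] i; [case: i | rewrite mul0r].
Qed.
Fact ser_1mul : right_id ser_one ser_mul.
Proof.
move=> x; apply/funext=> w; rewrite /ser_mul big_ord_recr /=.
rewrite take_size drop_size /ser_one mulr1 big1 ?add0r // => i _.
by rewrite /nilp size_drop subn_eq0 leqNgt ltn_ord mulr0.
Qed.
Fact ser_1neq0 : ser_one != 0.
Proof. by apply/eqP=> /(congr1 (@^~ [::]))/eqP; rewrite oner_eq0. Qed.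

HB.instance Definition _ := GRing.Zmodule_isNzRing.Build (series L)
  ser_mulA ser_mul1 ser_1mul ser_mulDl ser_mulDr ser_1neq0.

Fact ser_scaleA a b x : ser_scale a (ser_scale b x) = ser_scale (a * b) x.
Proof. by apply/funext=> w; apply: mulrA. Qed.
Fact ser_scale1 : left_id 1 ser_scale.
Proof. by move=> x; apply/funext=> w; apply: mul1r. Qed.
Fact ser_scaleDr : right_distributive ser_scale +%R.
Proof. by move=> c x y; apply/funext=> w; apply: mulrDr. Qed.
Fact ser_scaleDl x : {morph ser_scale^~ x : a b / a + b}.
Proof. by move=> a b; apply/funext=> w; apply: mulrDl. Qed.

HB.instance Definition _ := GRing.Zmodule_isLmodule.Build L (series L)
  ser_scaleA ser_scale1 ser_scaleDr ser_scaleDl.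
HB.instance Definition _ :=
  GRing.Lmodule_isLalgebra.Build L (series L) ser_scaleAl.
HB.instance Definition _ :=
  GRing.Lalgebra_isAlgebra.Build L (series L) ser_scaleAr.

Definition tau : series L := fun w => if w is [:: Tau] then 1 else 0.
Definition te : series L := fun w => if w is [:: Te] then 1 else 0.

(* sum_{i >= 1} c_i t^i; the value [c 0] is not used. *)
Definition tser (c : nat -> L) : series L := fun w =>
  if ~~ nilp w && ~~ has is_tau w then c (size w) else 0.

(* Terms of word length less than [n] vanish; these ideals are the basis of
   neighbourhoods of 0 in the natural topology. *)
Definition ord_ge (n : nat) x := forall w, (size w < n)%N -> x w = 0.

Definition ser_continuous (h : series L -> series L) :=
  forall n, exists m, forall x y, ord_ge m (x - y) -> ord_ge n (h x - h y).

(* The grading: |tau| = -1, |t| = -(d+2). *)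
Definition word_deg (d : int) (w : word) : int :=
  \sum_(a <- w) (if is_tau a then -1 else - (d + 2)).

Definition ser_deg (d : int) (dg : int -> L -> Prop) (n : int) x :=
  forall w, dg (n - word_deg d w) (x w).

(* x |-> (-1)^|x| x.  As L and t are even, the parity of a monomial is the
   number of letters tau in it; see [ser_sgn_deg]. *)
Definition ser_sgn x : series L := fun w => (-1) ^+ count is_tau w * x w.

(* A d/dtau + B d/dt as a derivation of odd degree: the letters of each word
   are replaced in turn, tau by A and t by B, with the sign (-1)^|p| where p is
   the part of the word to the left.  The coefficient at w collects the
   factorizations w = p q r with q coming from A or B.  See the lemmas
   [odder_tau], [odder_te], [odderM], [odderD], [odderZ],
   [odder_continuous]. *)
Definition odder (A B : series L) x : series L := fun w =>
  \sum_(i < (size w).+1) (-1) ^+ count is_tau (take i w) *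
    (A * lshift (rcons (take i w) Tau) x
     + B * lshift (rcons (take i w) Te) x) (drop i w).

Definition ad_tau x : series L := tau * x - ser_sgn x * tau.

(* (sum_{i >= 1} lam_i t^i) d/dtau + ad tau - tau^2 d/dtau *)
Definition moore_der (lam : nat -> L) x : series L :=
  odder (tser lam) 0 x + ad_tau x - odder (tau ^+ 2) 0 x.

Lemma serDE x y w : (x + y) w = x w + y w. Proof. by []. Qed.
Lemma serBE x y w : (x - y) w = x w - y w. Proof. by []. Qed.
Lemma serZE c x w : (c *: x) w = c * x w. Proof. by []. Qed.
Lemma serM_nil x y : (x * y) [::] = x [::] * y [::].
Proof. exact: ser_mul_nil. Qed.
Lemma serM_cons x y a w :
  (x * y) (a :: w) = x [::] * y (a :: w) + (lshift [:: a] x * y) w.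
Proof. exact: ser_mul_cons. Qed.
Lemma lshiftM a x y : lshift [:: a] (x * y) =
  x [::] *: lshift [:: a] y + lshift [:: a] x * y.
Proof. exact: lshift_mul. Qed.

Lemma odder_nil A B x : odder A B x [::] =
  (A * lshift [:: Tau] x + B * lshift [:: Te] x) [::].
Proof. by rewrite /odder big_ord_recl big_ord0 addr0 mul1r. Qed.

Lemma odder_cons A B x a w : odder A B x (a :: w) =
  (A * lshift [:: Tau] x + B * lshift [:: Te] x) (a :: w)
  + (-1) ^+ is_tau a * odder A B (lshift [:: a] x) w.
Proof.
rewrite /odder big_ord_recl mul1r; congr (_ + _).
by rewrite mulr_sumr; apply: eq_bigr => i _; rewrite mulrA -exprD.
Qed.

Lemma odderD A B x y : odder A B (x + y) = odder A B x + odder A B y.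
Proof.
apply/funext=> w; rewrite -[RHS]big_split; apply: eq_bigr => i _.
by rewrite /= -mulrDr -serDE addrACA -!mulrDr.
Qed.

Lemma odderZ A B c x : odder A B (c *: x) = c *: odder A B x.
Proof.
apply/funext=> w; rewrite serZE mulr_sumr; apply: eq_bigr => i _.
by rewrite [RHS]mulrCA -[c * _]serZE scalerDr !scalerAr.
Qed.

Lemma odderM A B x y :
  odder A B (x * y) = odder A B x * y + ser_sgn x * odder A B y.
Proof.
pose E z : series L := A * lshift [:: Tau] z + B * lshift [:: Te] z.
have EM z t : E (z * t) = z [::] *: E t + E z * t.
  by rewrite /E !lshiftM !mulrDr scalerDr mulrDl -!scalerAr addrACA !mulrA.
have sE a z : lshift [:: a] (odder A B z) =
    lshift [:: a] (E z) + (-1) ^+ is_tau a *: odder A B (lshift [:: a] z).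
  by apply/funext=> w; rewrite [LHS]odder_cons.
have sS a z : lshift [:: a] (ser_sgn z) =
    (-1) ^+ is_tau a *: ser_sgn (lshift [:: a] z).
  by apply/funext=> w; rewrite /lshift serZE /ser_sgn /= exprD mulrA.
have S0 z : ser_sgn z [::] = z [::] by rewrite /ser_sgn mul1r.
apply/funext=> w; elim: w x y => [|a w IHw] x y.
  by rewrite odder_nil -/(E _) EM !serDE !serM_nil serZE S0 !odder_nil addrC.
rewrite odder_cons -/(E _) EM lshiftM !odderD odderZ !serDE !serZE IHw.
rewrite !serM_cons S0 odder_nil -/(E x) odder_cons -/(E y) !serDE.
rewrite sE sS (mulrDl (lshift _ (E x))) serDE -!scalerAl !serZE !mulrDr.
by ring.
Qed.

Lemma lshift_nil x : lshift [::] x = x. Proof. by []. Qed.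

Lemma odder0 A B : odder A B 0 = 0.
Proof. by have := odderZ A B 0 0; rewrite !scale0r. Qed.

Lemma odder1 A B : odder A B 1 = 0.
Proof.
have /eqP := odderM A B 1 1.
have -> : ser_sgn 1 = 1 :> series L.
  apply/funext=> -[|a w]; rewrite /ser_sgn ?mul1r //.
  by rewrite /GRing.one /= /ser_one mulr0.
by rewrite !mul1r mulr1 -subr_eq0 opprD addrA subrr sub0r oppr_eq0 => /eqP.
Qed.

Lemma odder_tau A B : odder A B tau = A.
Proof.
have s1 : lshift [:: Tau] tau = 1 by apply/funext=> -[].
have s0 : lshift [:: Te] tau = 0 by apply/funext=> -[].
apply/funext=> -[|a w]; rewrite ?odder_nil ?odder_cons s1 s0 mulr1 mulr0 addr0 //.
by case: a; rewrite ?s1 ?s0 ?odder1 ?odder0 mulr0 addr0.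
Qed.

Lemma odder_te A B : odder A B te = B.
Proof.
have s1 : lshift [:: Te] te = 1 by apply/funext=> -[].
have s0 : lshift [:: Tau] te = 0 by apply/funext=> -[].
apply/funext=> -[|a w]; rewrite ?odder_nil ?odder_cons s1 s0 mulr1 mulr0 add0r //.
by case: a; rewrite ?s1 ?s0 ?odder1 ?odder0 mulr0 addr0.
Qed.

Lemma odder_continuous A B : ser_continuous (odder A B).
Proof.
move=> n; exists n.+1 => x y xy w ltwn; rewrite serBE.
have -> : odder A B x w - odder A B y w = odder A B (x - y) w.
  by rewrite -[- y]scaleN1r odderD odderZ scaleN1r.
have z0 C p r : (size p + size r <= size w)%N -> forall a,
    (C * lshift (rcons p a) (x - y)) r = 0.
  move=> le_pr a; apply: big1 => i _; rewrite [lshift _ _ _]xy ?mulr0 //.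
  rewrite size_cat size_rcons size_drop addSn ltnS.
  by apply: leq_ltn_trans ltwn; apply: leq_trans le_pr; rewrite leq_add2l leq_subr.
apply: big1 => i _; rewrite serDE !z0 ?addr0 ?mulr0 //.
all: by rewrite -size_cat cat_take_drop.
Qed.

Lemma ser_sgn_deg d dg n x : even_grading dg -> (2 %| d)%Z ->
  ser_deg d dg n x -> ser_sgn x = (-1) ^+ `|n|%N *: x.
Proof.
move=> evdg ev_d xn; apply/funext=> w; rewrite serZE /ser_sgn.
have [nw|/(egr_even evdg (xn w)) ->] := boolP (2 %| n - word_deg d w)%Z; last first.
  by rewrite !mulr0.
have ww : (2 %| word_deg d w + (count is_tau w)%:Z)%Z.
  rewrite /word_deg; elim: w {nw} => [|a w IHw]; first by rewrite big_nil.
  rewrite big_cons /= PoszD addrACA rpredD //.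
  by case: a => //=; rewrite addr0 rpredN rpredD.
congr (_ * _); rewrite -signr_odd -[RHS]signr_odd; congr (_ ^+ nat_of_bool _).
have := rpredD nw ww; rewrite addrA subrK dvdzE /= dvdn2.
by case: n {xn nw} => n; rewrite ?NegzE -?PoszD /= ?oddD //; lia.
Qed.
End SeriesAlgebra.

Definition is_moore (d : int) (L : comNzRingType) (dg : int -> L -> Prop)
    (m : series L -> series L) :=
  exists lam : nat -> L,
    (forall i, (0 < i)%N -> dg (i%:Z * (d + 2) - 2) (lam i)) /\
    forall x, m x = moore_der lam x.

Definition smap (L L' : comNzRingType) (f : L -> L') (x : series L) : series L' :=
  fun w => f (x w).

(* For m of degree -1, f_*m = f(m tau) d/dtau + f(m t) d/dt. *)
Definition pushforward (L L' : comNzRingType) (f : L -> L')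
    (m : series L -> series L) : series L' -> series L' :=
  odder (smap f (m (tau L))) (smap f (m (te L))).

Record unital_iso (d : int) (L : comNzRingType) (dg : int -> L -> Prop)
    (phi : series L -> series L) : Prop := {
  uiso_bij : bijective phi;
  uiso_cont : ser_continuous phi;
  uiso_deg : forall n x, ser_deg d dg n x -> ser_deg d dg n (phi x);
  uiso_form : exists G F : nat -> L,
    [/\ phi (tau L) = tau L + tser G, phi (te L) = tser F &
        exists y, F 1%N * y = 1]
}.

Section Deformations.
Variables (R : comNzRingType) (dgR : int -> R -> Prop) (d : int).

Record augmented := Augmented {
  aug_alg :> comAlgType R;
  aug_deg : int -> aug_alg -> Prop;
  aug_even : even_grading aug_deg;
  aug_in_deg : forall n r, dgR n r -> aug_deg n (r%:A);
  aug_eps : {lrmorphism aug_alg -> R | *%R};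
  aug_eps_deg : forall n x, aug_deg n x -> dgR n (aug_eps x)
}.

Definition aug_hom (B B' : augmented) (f : {lrmorphism B -> B'}) :=
  (forall n x, aug_deg n x -> aug_deg n (f x)) /\
  forall x, aug_eps B' (f x) = aug_eps B x.

Definition is_deformation (m : series R -> series R) (B : augmented)
    (mB : series B -> series B) :=
  is_moore d (@aug_deg B) mB /\
  forall x, smap (aug_eps B) (mB x) = m (smap (aug_eps B) x).

Definition def_equiv (B : augmented) (m1 m2 : series B -> series B) :=
  exists phi : {lrmorphism series B -> series B},
    [/\ unital_iso d (@aug_deg B) phi,
        forall x, phi (m1 x) = m2 (phi x) &
        forall x, smap (aug_eps B) (phi x) = smap (aug_eps B) x].

Definition classifies (B B' : augmented) (mB : series B -> series B)
    (mB' : series B' -> series B') (f : {lrmorphism B -> B'}) :=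
  aug_hom f /\ def_equiv (pushforward f mB) mB'.

Definition infinitesimal (B : augmented) :=
  forall x y : B, aug_eps B x = 0 -> aug_eps B y = 0 -> x * y = 0.

Definition versal m (B : augmented) (mB : series B -> series B) :=
  is_deformation m mB /\
  forall (B' : augmented) (mB' : series B' -> series B'),
    is_deformation m mB' -> exists f, classifies mB mB' f.

Definition miniversal m (B : augmented) (mB : series B -> series B) :=
  versal m mB /\
  forall (B' : augmented) (mB' : series B' -> series B'),
    infinitesimal B' -> is_deformation m mB' ->
    forall f g, classifies mB mB' f -> classifies mB mB' g -> f =1 g.

End Deformations.

(* Polynomials in countably many variables; the variable with index k : nat is
   u_(k+1). *)
Notation upoly R := {malg R[{cmonom nat}]}.

Definition upoly_var (R : comNzRingType) (i : nat) : upoly R := << ucm i.-1 >>.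

(* The degree of a monomial in the u_i when |u_i| = i(d+2) - 2. *)
Definition umon_deg (d : int) (k : {cmonom nat}) : int :=
  \sum_(j <- finsupp k) (k j)%:Z * (j.+1%:Z * (d + 2) - 2).

Definition upoly_deg (R : comNzRingType) (dgR : int -> R -> Prop) (d n : int)
    (p : upoly R) :=
  forall k, dgR (n - umon_deg d k) (mcoeff k p).

(* The augmentation u_i |-> 0 takes the constant term. *)
Definition upoly_eps (R : comNzRingType) : upoly R -> R := mcoeff mone.
HB.instance Definition _ (R : comNzRingType) :=
  GRing.RMorphism.copy (@upoly_eps R) (mcoeff mone).
HB.instance Definition _ (R : comNzRingType) :=
  GRing.isScalable.Build R (upoly R) R *%R (@upoly_eps R)
    (fun c => (mcoeffZ c)^~ mone).

Section UniversalBase.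
Variables (R : comNzRingType) (dgR : int -> R -> Prop).
Hypothesis evR : even_grading dgR.
Variable d : int.
Hypothesis ev_d : (2 %| d)%Z.

Lemma umon_degEw (E : {fset nat}) (k : {cmonom nat}) : (finsupp k `<=` E)%fset ->
  umon_deg d k = \sum_(j <- E) (k j)%:Z * (j.+1%:Z * (d + 2) - 2).
Proof.
move=> le; rewrite /umon_deg (big_fset_incl _ le) // => j _.
by rewrite -cmE_neq0 negbK => /eqP ->; rewrite mul0r.
Qed.

Lemma umon_deg1 : umon_deg d (mone : {cmonom nat}) = 0.
Proof. by rewrite /umon_deg mdom1 big_seq_fset0. Qed.

Lemma umon_degM k l : umon_deg d (mmul k l) = umon_deg d k + umon_deg d l.
Proof.
rewrite {1}/umon_deg mdomD (umon_degEw (fsubsetUl _ (finsupp l))).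
rewrite (umon_degEw (fsubsetUr (finsupp k) _)) -big_split /=.
by apply: eq_bigr => j _; rewrite cmM PoszD mulrDl.
Qed.

Lemma umon_deg_even k : (2 %| umon_deg d k)%Z.
Proof.
apply: rpred_sum => j _; apply: dvdz_mull; rewrite rpredB ?dvdzz //.
by apply: dvdz_mull; rewrite rpredD.
Qed.

Lemma egrD n x y : dgR n x -> dgR n y -> dgR n (x + y).
Proof.
by move=> xn yn; rewrite -[y]opprK; apply: egrB => //; rewrite -sub0r;
  apply: egrB => //; apply: egr0.
Qed.

Lemma upoly_even : even_grading (upoly_deg dgR d).
Proof.
split.
- by move=> n k; rewrite mcoeff0; apply: egr0.
- by move=> n p q pn qn k; rewrite mcoeffB; apply: egrB.
- move=> k; rewrite mcoeff1; case: eqP => [->|_]; last exact: egr0.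
  by rewrite umon_deg1 subr0; apply: egr1.
- move=> m n p q pm qn k; rewrite mcoeffMl.
  have sumD (I : Type) (s : seq I) (F : I -> R) e :
      (forall i, dgR e (F i)) -> dgR e (\sum_(i <- s) F i).
    by move=> Fe; elim/big_ind: _ => //; [apply: egr0 | apply: egrD].
  apply: (sumD) => k1; apply: (sumD) => k2.
  case: eqP => [<-|_]; last exact: egr0.
  by rewrite mulr1n umon_degM opprD addrACA; apply: egrM.
- move=> p; rewrite [p]monalgE; elim/big_ind: _.
  + by exists [::]; rewrite big_nil.
  + move=> _ _ [s [hs ->]] [t [ht ->]]; exists (s ++ t); rewrite big_cat.
    by split=> // z; rewrite mem_cat => /orP[/hs|/ht].
  + move=> k _; have [s [hs ->]] := egr_gen evR (mcoeff k p).
    exists [seq (z.1 + umon_deg d k, << z.2 *g k >>) | z <- s].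
    rewrite big_map raddf_sum; split=> // _ /mapP[z /hs zs ->] l /=.
    rewrite mcoeffU; case: eqP => [<-|_]; last exact: egr0.
    by rewrite addrK mulr1n.
- move=> s f uniq_s fn sum0 n ns; apply/malgP=> k; rewrite mcoeff0.
  pose sh e := e - umon_deg d k.
  have shK : cancel sh (fun e => e + umon_deg d k).
    by move=> e; rewrite /sh subrK.
  rewrite -[n]shK; apply: (egr_indep evR (s := map sh s)
    (f := fun e => mcoeff k (f (e + umon_deg d k)))).
  + by rewrite map_inj_uniq //; apply: can_inj shK.
  + by move=> e; have := fn (e + umon_deg d k) k; rewrite addrK.
  + rewrite big_map; have /(congr1 (mcoeff k)) := sum0.
    by rewrite raddf_sum mcoeff0 => {2}<-; apply: eq_bigr => e _; rewrite shK.
  + exact: map_f.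
- move=> n p pn odd_n; apply/malgP=> k; rewrite mcoeff0.
  apply: (egr_even evR (pn k)); apply: contra odd_n => odd_nk.
  by rewrite -(subrK (umon_deg d k) n) rpredD ?umon_deg_even.
Qed.

Lemma upoly_in_deg n r : dgR n r -> upoly_deg dgR d n (r%:A : upoly R).
Proof.
move=> rn k; rewrite mcoeffZ mcoeff1; case: eqP => [->|_].
  by rewrite mulr1 umon_deg1 subr0.
by rewrite mulr0; apply: egr0.
Qed.

Lemma upoly_eps_deg n (p : upoly R) :
  upoly_deg dgR d n p -> dgR n (upoly_eps p).
Proof. by move=> /(_ mone); rewrite umon_deg1 subr0. Qed.

Definition universal_base : augmented dgR :=
  @Augmented R dgR (upoly R) (upoly_deg dgR d) upoly_even upoly_in_deg
    (@upoly_eps R) upoly_eps_deg.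

Lemma upoly_var_eps i : aug_eps universal_base (upoly_var R i) = 0.
Proof. by rewrite /= /upoly_eps mcoeffU1 cm1_eq1. Qed.

Lemma upoly_var_deg i : (0 < i)%N ->
  aug_deg (a := universal_base) (i%:Z * (d + 2) - 2) (upoly_var R i).
Proof.
move=> i_gt0 k; rewrite mcoeffU1; case: eqP => [<-|_]; last exact: egr0.
rewrite /umon_deg mdomU big_seq_fset1 cmUU mul1r prednK // subrr.
exact: egr1.
Qed.

End UniversalBase.

(* Main.v *)
From HB Require Import structures.
From mathcomp Require Import all_boot all_order all_algebra.
From mathcomp Require Import boolp.
From mathcomp Require Import finmap monalg.
Require Import Defs.
Import GRing.Theory.
Local Open Scope ring_scope.

Set Implicit Arguments.
Unset Strict Implicit.
Unset Printing Implicit Defensive.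

(** Write m(lam) for the Moore structure with parameters lam_i.  It sends tau to
    sum lam_i t^i + tau^2 and t to [tau, t], and an odd derivation is determined
    by its values on tau and t ([odd_derivationE]); hence changing coefficients
    along f turns m(lam) into m(f lam) ([pushforward_moore]).

    Versality.  If m(lam) deforms the trivial structure, then comparing the
    coefficients of t^i in the value at tau shows that every lam_i lies in the
    augmentation ideal ([moore_deformation_eps]).  The evaluation u_i |-> lam_i is
    therefore a homomorphism of augmented algebras, and it pushes the universal
    structure forward to m(lam) itself, so that the identity is an equivalence.

    Uniqueness.  Let the augmentation ideal I have square zero, and let phi be an
    equivalence from m(lam) to m(mu) with all lam_i and mu_i in I.  As phi is the
    identity modulo I, it fixes every series with coefficients in I
    ([unipotent_fix]), and phi(tau) = tau + y with y in I.  So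

      phi(m(lam) tau) = sum lam_i t^i + tau^2 + tau y + y tau,
      m(mu)(phi tau)  = sum mu_i t^i + tau^2 + m(mu) y,

    and as mu_i y = 0, every term of m(mu) y contains the letter tau.  The
    coefficients of t^i give lam_i = mu_i ([moore_equiv_infinitesimal]): two
    equivalent infinitesimal deformations of the trivial structure have the same
    parameters.  A classifying homomorphism has therefore no choice but to send
    u_i to lam_i. *)

(** * Series and the first letter of a word *)

Lemma tauM_nil (L : comNzRingType) (x : series L) : (tau L * x) [::] = 0.
Proof. by rewrite serM_nil mul0r. Qed.

Lemma teM_nil (L : comNzRingType) (x : series L) : (te L * x) [::] = 0.
Proof. by rewrite serM_nil mul0r. Qed.

Lemma lshift_tau (L : comNzRingType) a : lshift [:: a] (tau L) = (is_tau a)%:R.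
Proof. by apply/funext; case: a => -[]. Qed.

Lemma lshift_te (L : comNzRingType) a : lshift [:: a] (te L) = (~~ is_tau a)%:R.
Proof. by apply/funext; case: a => -[]. Qed.

Lemma tauM_cons (L : comNzRingType) (x : series L) a w :
  (tau L * x) (a :: w) = if is_tau a then x w else 0.
Proof.
by rewrite serM_cons mul0r add0r lshift_tau; case: a; rewrite ?mul1r ?mul0r.
Qed.

Lemma teM_cons (L : comNzRingType) (x : series L) a w :
  (te L * x) (a :: w) = if is_tau a then 0 else x w.
Proof.
by rewrite serM_cons mul0r add0r lshift_te; case: a; rewrite ?mul1r ?mul0r.
Qed.

(** A series is a constant plus left multiples of tau and t.  A map whose
    effect on left multiples by a letter is known can thus be computed
    coefficientwise, by induction on the word. *)
Lemma ser_first_letter (L : comNzRingType) (x : series L) :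
  x = x [::] *: 1 + (tau L * lshift [:: Tau] x + te L * lshift [:: Te] x).
Proof.
apply/funext=> -[|a w]; rewrite !serDE serZE.
  by rewrite tauM_nil teM_nil !addr0 [X in _ * X]/(1 : L) mulr1.
rewrite tauM_cons teM_cons [X in _ * X]/(0 : L) mulr0 add0r.
by case: a; rewrite ?addr0 ?add0r.
Qed.

Lemma tauM_notau (L : comNzRingType) (x : series L) w :
  ~~ has is_tau w -> (tau L * x) w = 0.
Proof. by case: w => [|[] w] //; rewrite ?tauM_nil // tauM_cons. Qed.

Lemma Mtau_notau (L : comNzRingType) (x : series L) w :
  ~~ has is_tau w -> (x * tau L) w = 0.
Proof.
elim: w x => [|a w IHw] x; first by rewrite serM_nil mulr0.
rewrite /= negb_or => /andP[na nw]; rewrite serM_cons IHw // addr0.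
by case: a na w {IHw nw} => // _ w; rewrite mulr0.
Qed.

(** * Odd derivations *)

Definition odd_derivation (L : comNzRingType) (D : series L -> series L) :=
  (forall c x y, D (c *: x + y) = c *: D x + D y) /\
  (forall x y, D (x * y) = D x * y + ser_sgn x * D y).

Lemma ser_sgnD (L : comNzRingType) (x y : series L) :
  ser_sgn (x + y) = ser_sgn x + ser_sgn y.
Proof. by apply/funext=> w; rewrite /ser_sgn !serDE mulrDr. Qed.

Lemma ser_sgnZ (L : comNzRingType) c (x : series L) :
  ser_sgn (c *: x) = c *: ser_sgn x.
Proof. by apply/funext=> w; rewrite serZE /ser_sgn serZE mulrCA. Qed.

Lemma ser_sgnM (L : comNzRingType) (x y : series L) :
  ser_sgn (x * y) = ser_sgn x * ser_sgn y.
Proof.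
apply/funext=> w; rewrite /ser_sgn mulr_sumr; apply: eq_bigr => i _.
rewrite -{1}(cat_take_drop i w) count_cat exprD -!mulrA; congr (_ * _).
by rewrite mulrCA.
Qed.

Lemma ser_sgn_tau (L : comNzRingType) : ser_sgn (tau L) = - tau L.
Proof.
apply/eqP; rewrite -addr_eq0; apply/eqP/funext=> w; rewrite serDE /ser_sgn.
by case: w => [|[] [|b w]]; rewrite /= ?mulr0 ?addr0 // mulr1 addNr.
Qed.

Lemma ser_sgn_te (L : comNzRingType) : ser_sgn (te L) = te L.
Proof.
apply/funext=> w; rewrite /ser_sgn.
by case: w => [|[] [|b w]]; rewrite /= ?mulr0 ?mulr1.
Qed.

Lemma odd_derivation_odder (L : comNzRingType) (A B : series L) :
  odd_derivation (odder A B).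
Proof. by split=> *; rewrite ?odderM // odderD odderZ. Qed.

Lemma odd_derivation_ad_tau (L : comNzRingType) : odd_derivation (@ad_tau L).
Proof.
split=> [c x y|x y]; rewrite /ad_tau.
  rewrite ser_sgnD ser_sgnZ mulrDr mulrDl opprD addrACA scalerBr.
  by rewrite -scalerAr -scalerAl.
by rewrite ser_sgnM mulrBl mulrBr !mulrA addrA subrK.
Qed.

Lemma odd_derivationB (L : comNzRingType) (D D' : series L -> series L) :
  odd_derivation D -> odd_derivation D' ->
  odd_derivation (fun x => D x - D' x).
Proof.
move=> [Dl DM] [D'l D'M]; split=> [c x y|x y].
  by rewrite Dl D'l opprD addrACA scalerBr.
by rewrite DM D'M opprD addrACA mulrBl mulrBr.
Qed.

Lemma odd_derivationD (L : comNzRingType) (D D' : series L -> series L) :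
  odd_derivation D -> odd_derivation D' ->
  odd_derivation (fun x => D x + D' x).
Proof.
move=> [Dl DM] [D'l D'M]; split=> [c x y|x y].
  by rewrite Dl D'l addrACA scalerDr.
by rewrite DM D'M addrACA mulrDl mulrDr.
Qed.

Lemma odd_derivation_moore (L : comNzRingType) (lam : nat -> L) :
  odd_derivation (moore_der lam).
Proof.
apply: odd_derivationB; last exact: odd_derivation_odder.
apply: odd_derivationD; first exact: odd_derivation_odder.
exact: odd_derivation_ad_tau.
Qed.

(** Peeling off the first letter, D x = t D(x_t) - tau D(x_tau), where x_t and
    x_tau are the left quotients of x: the coefficient of D x at a word reduces
    to one at a shorter word. *)
Lemma odd_derivation_eq0 (L : comNzRingType) (D : series L -> series L) :
  odd_derivation D -> D (tau L) = 0 -> D (te L) = 0 -> forall x, D x = 0.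
Proof.
move=> [Dl DM] Dtau Dte x.
have DD y z : D (y + z) = D y + D z by rewrite -{1}[y]scale1r Dl scale1r.
have D0 : D 0 = 0 by apply: (@addrI _ (D 0)); rewrite -DD !addr0.
have DZ c y : D (c *: y) = c *: D y by rewrite -[c *: y]addr0 Dl D0 addr0.
have sgn1 : ser_sgn 1 = 1 :> series L.
  apply/funext=> -[|a w]; rewrite /ser_sgn ?mul1r //.
  by rewrite [X in _ * X]/(0 : L) mulr0.
have D1 : D 1 = 0.
  by apply: (@addrI _ (D 1)); rewrite addr0 -[in RHS](mulr1 1) DM sgn1 mulr1 mul1r.
have DE y : D y = te L * D (lshift [:: Te] y) - tau L * D (lshift [:: Tau] y).
  rewrite {1}[y]ser_first_letter !DD !DM DZ D1 Dtau Dte scaler0 !mul0r !add0r.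
  by rewrite ser_sgn_tau ser_sgn_te mulNr addrC.
apply/funext=> w; elim: w x => [|a w IHw] x; rewrite DE serBE.
  by rewrite tauM_nil teM_nil subr0.
by rewrite tauM_cons teM_cons !IHw !if_same subr0.
Qed.

Lemma odd_derivationE (L : comNzRingType) (D : series L -> series L) :
  odd_derivation D -> forall x, D x = odder (D (tau L)) (D (te L)) x.
Proof.
move=> derD x; apply/eqP; rewrite -subr_eq0; apply/eqP.
pose E y := D y - odder (D (tau L)) (D (te L)) y.
apply: (@odd_derivation_eq0 _ E); rewrite /E ?odder_tau ?odder_te ?subrr //.
by apply: odd_derivationB => //; apply: odd_derivation_odder.
Qed.

Lemma moore_der_tau (L : comNzRingType) (lam : nat -> L) :
  moore_der lam (tau L) = tser lam + tau L ^+ 2.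
Proof.
by rewrite /moore_der !odder_tau /ad_tau ser_sgn_tau mulNr opprK expr2 addrA addrK.
Qed.

(** * Change of coefficients *)

Lemma smapE (L L' : comNzRingType) (f : L -> L') (x : series L) w :
  smap f x w = f (x w).
Proof. by []. Qed.

Lemma smapD (L L' : comNzRingType) (f : {rmorphism L -> L'}) x y :
  smap f (x + y) = smap f x + smap f y.
Proof. by apply/funext=> w; apply: rmorphD. Qed.

Lemma smapB (L L' : comNzRingType) (f : {rmorphism L -> L'}) x y :
  smap f (x - y) = smap f x - smap f y.
Proof. by apply/funext=> w; apply: rmorphB. Qed.

Lemma smapM (L L' : comNzRingType) (f : {rmorphism L -> L'}) x y :
  smap f (x * y) = smap f x * smap f y.
Proof.
apply/funext=> w; rewrite smapE rmorph_sum; apply: eq_bigr => i _.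
exact: rmorphM.
Qed.

Lemma smap_tau (L L' : comNzRingType) (f : {rmorphism L -> L'}) :
  smap f (tau L) = tau L'.
Proof.
by apply/funext=> -[|[] [|b w]]; rewrite smapE /tau ?rmorph0 ?rmorph1.
Qed.

Lemma smap_te (L L' : comNzRingType) (f : {rmorphism L -> L'}) :
  smap f (te L) = te L'.
Proof.
by apply/funext=> -[|[] [|b w]]; rewrite smapE /te ?rmorph0 ?rmorph1.
Qed.

Lemma smap_tser (L L' : comNzRingType) (f : {rmorphism L -> L'}) lam :
  smap f (tser lam) = tser (f \o lam).
Proof.
by apply/funext=> w; rewrite smapE /tser; case: ifP; rewrite ?rmorph0.
Qed.

Lemma smap_sgn (L L' : comNzRingType) (f : {rmorphism L -> L'}) x :
  smap f (ser_sgn x) = ser_sgn (smap f x).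
Proof. by apply/funext=> w; rewrite smapE rmorphMsign. Qed.

Lemma smap_odder (L L' : comNzRingType) (f : {rmorphism L -> L'}) A B x :
  smap f (odder A B x) = odder (smap f A) (smap f B) (smap f x).
Proof.
apply/funext=> w; rewrite smapE rmorph_sum; apply: eq_bigr => i _.
by rewrite rmorphMsign -[f _]smapE smapD !smapM.
Qed.

Lemma smap_moore (L L' : comNzRingType) (f : {rmorphism L -> L'}) lam x :
  smap f (moore_der lam x) = moore_der (f \o lam) (smap f x).
Proof.
have smap0 : smap f 0 = 0 by apply/funext=> w; apply: rmorph0.
rewrite smapB smapD !smap_odder smapB !smapM smap_tser smap_tau smap_sgn.
by rewrite smap0.
Qed.

(** Push-forward is defined by the values on the two generators; it agrees with
    the Moore derivation because both are odd derivations. *)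
Lemma pushforward_moore (L L' : comNzRingType) (f : {rmorphism L -> L'}) lam :
  pushforward f (moore_der lam) =1 moore_der (f \o lam).
Proof.
move=> x; rewrite /pushforward !smap_moore smap_tau smap_te.
by rewrite -odd_derivationE //; apply: odd_derivation_moore.
Qed.

Lemma eq_tser (L : comNzRingType) (lam mu : nat -> L) :
  (forall i, (0 < i)%N -> lam i = mu i) -> tser lam = tser mu.
Proof.
move=> eq_lm; apply/funext=> w; rewrite /tser; case: ifP => // /andP[nw _].
by apply: eq_lm; case: w nw.
Qed.

Lemma tser_nseq (L : comNzRingType) (lam : nat -> L) i :
  (0 < i)%N -> tser lam (nseq i Te) = lam i.
Proof.
by move=> i_gt0; rewrite /tser size_nseq has_nseq andbF andbT; case: i i_gt0.
Qed.

(** * Homomorphisms out of the polynomial ring *)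

Lemma cmonom_ind (I : choiceType) (P : {cmonom I} -> Prop) :
  P mone -> (forall i k, P k -> P (mmul (ucm i) k)) -> forall k, P k.
Proof.
move=> P1 PM k; have [n] := ubnP (mdeg k); elim: n k => // n IHn k lt_kn.
have [->//|/eqP k_neq1] := eqVneq k mone.
have [i ki] : exists i, i \in finsupp k.
  apply: contrapT => no_i; apply: k_neq1; apply/eqP/cmP=> i; rewrite cm1.
  by apply/eqP; rewrite cmE_eq0; apply/negP=> ki; apply: no_i; exists i.
have kE : k = mmul (ucm i) (divcm k (ucm i)).
  apply/eqP/cmP=> j; rewrite cmM divcmE cmU subnKC //.
  by have [<-|//] := eqVneq i j; rewrite lt0n cmE_neq0.
by rewrite kE; apply/PM/IHn; move: lt_kn; rewrite {1}kE mdegM mdegU.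
Qed.

(** The index shift is that of the variables: the exponent at j is that of
    u_(j+1). *)
Definition monom_eval (L : comNzRingType) (v : nat -> L) (k : {cmonom nat}) : L :=
  \prod_(j <- finsupp k) v j.+1 ^+ k j.

Lemma monom_evalEw (L : comNzRingType) (v : nat -> L) (E : {fset nat})
    (k : {cmonom nat}) :
  (finsupp k `<=` E)%fset -> monom_eval v k = \prod_(j <- E) v j.+1 ^+ k j.
Proof.
move=> le; rewrite /monom_eval (big_fset_incl _ le) // => j _.
by rewrite -cmE_neq0 negbK => /eqP ->.
Qed.

Lemma monom_eval_mmorphism (L : comNzRingType) (v : nat -> L) :
  mmorphism (monom_eval v).
Proof.
split=> [k l|]; last by rewrite /monom_eval mdom1 big_seq_fset0.
rewrite {1}/monom_eval mdomD (monom_evalEw _ (fsubsetUl _ (finsupp l))).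
rewrite (monom_evalEw _ (fsubsetUr (finsupp k) _)) -big_split /=.
by apply: eq_bigr => j _; rewrite cmM exprD.
Qed.

HB.instance Definition _ (L : comNzRingType) (v : nat -> L) :=
  isMultiplicative.Build {cmonom nat} L (monom_eval v) (monom_eval_mmorphism v).

Definition upoly_eval (R : comNzRingType) (L : comAlgType R) (v : nat -> L) :
  upoly R -> L := mmap (in_alg L) (monom_eval v).

HB.instance Definition _ (R : comNzRingType) (L : comAlgType R) (v : nat -> L) :=
  GRing.RMorphism.copy (upoly_eval v) (mmap (in_alg L) (monom_eval v)).

Lemma upoly_eval_scalable (R : comNzRingType) (L : comAlgType R) (v : nat -> L) :
  scalable (upoly_eval v).
Proof. by move=> c p; rewrite /upoly_eval mmapZ /= mulr_algl. Qed.

HB.instance Definition _ (R : comNzRingType) (L : comAlgType R) (v : nat -> L) :=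
  GRing.isScalable.Build R (upoly R) L *:%R (upoly_eval v)
    (@upoly_eval_scalable R L v).

Lemma upoly_eval_var (R : comNzRingType) (L : comAlgType R) (v : nat -> L) i :
  (0 < i)%N -> upoly_eval v (upoly_var R i) = v i.
Proof.
move=> i_gt0; rewrite /upoly_eval /upoly_var mmapU /= scale1r mul1r.
by rewrite /monom_eval mdomU big_seq_fset1 cmUU prednK.
Qed.

Lemma monomialM (R : comNzRingType) (c1 c2 : R) (k1 k2 : {cmonom nat}) :
  << c1 *g k1 >> * << c2 *g k2 >> = << c1 * c2 *g mmul k1 k2 >> :> upoly R.
Proof. exact: fgmulUU. Qed.

Lemma upoly_rmorph_ext (R : comNzRingType) (L : nzRingType)
    (f g : {rmorphism upoly R -> L}) :
  (forall c, f c%:A = g c%:A) ->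
  (forall i, (0 < i)%N -> f (upoly_var R i) = g (upoly_var R i)) -> f =1 g.
Proof.
move=> fgA fgU.
have fgC c : f c%:MP = g c%:MP by rewrite -[c%:MP]mulr1 mul_malgC.
have fgM x y : f x = g x -> f y = g y -> f (x * y) = g (x * y).
  by move=> fgx fgy; rewrite (rmorphM f) (rmorphM g) fgx fgy.
have fgk k : f << k >> = g << k >>.
  elim/cmonom_ind: k => [|i k IHk]; first exact: fgC.
  rewrite -[X in << X *g _ >>]mulr1 -monomialM.
  exact: (fgM _ _ (fgU i.+1 isT) IHk).
move=> p; rewrite [p]monalgE !rmorph_sum; apply: eq_bigr => k _.
rewrite -[X in << X *g _ >>]mulr1 -[k in << _ *g k >>]mul1m -monomialM.
exact: (fgM _ _ (fgC _) (fgk k)).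
Qed.

Lemma egr_prod (L : comNzRingType) (dg : int -> L -> Prop) (I : Type)
    (s : seq I) (n : I -> int) (x : I -> L) :
  even_grading dg -> (forall i, dg (n i) (x i)) ->
  dg (\sum_(i <- s) n i) (\prod_(i <- s) x i).
Proof.
move=> evdg dgx; elim: s => [|i s IHs].
  by rewrite !big_nil; apply: egr1 evdg.
by rewrite !big_cons; apply: egrM.
Qed.

Lemma egr_sum (L : comNzRingType) (dg : int -> L -> Prop) n (I : Type)
    (s : seq I) (x : I -> L) :
  even_grading dg -> (forall i, dg n (x i)) -> dg n (\sum_(i <- s) x i).
Proof.
move=> evdg dgx; elim/big_ind: _ => // [|y z]; first exact: egr0.
exact: egrD.
Qed.

Lemma egr_exp (L : comNzRingType) (dg : int -> L -> Prop) n (x : L) k :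
  even_grading dg -> dg n x -> dg (k%:Z * n) (x ^+ k).
Proof.
move=> evdg dgx; elim: k => [|k IHk]; first by rewrite mul0r; apply: egr1 evdg.
by rewrite exprS intS mulrDl mul1r; apply: egrM.
Qed.

(** The parameters of a Moore structure have the degrees prescribed for the
    variables, so evaluating at them preserves degrees. *)
Lemma upoly_eval_deg (R : comNzRingType) (dgR : int -> R -> Prop) (d : int)
    (B : augmented dgR) (v : nat -> B) :
  (forall i, (0 < i)%N -> aug_deg (i%:Z * (d + 2) - 2) (v i)) ->
  forall n p, upoly_deg dgR d n p -> aug_deg n (upoly_eval v p).
Proof.
move=> dgv n p pn; have evB := aug_even B.
apply: (egr_sum _ evB) => k; rewrite -[n](subrK (umon_deg d k)).
apply: (egrM evB); first exact/aug_in_deg/pn.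
by apply: (egr_prod _ evB) => j; apply: egr_exp => //; apply: dgv.
Qed.

(** * Equivalent infinitesimal deformations *)

Lemma infinitesimal_serM (R : comNzRingType) (dgR : int -> R -> Prop)
    (B : augmented dgR) (x y : series B) :
  infinitesimal B -> smap (aug_eps B) x = 0 -> smap (aug_eps B) y = 0 ->
  x * y = 0.
Proof.
move=> infB x0 y0; apply/funext=> w; apply: big1 => i _; apply: infB.
  exact: (congr1 (@^~ _) x0).
exact: (congr1 (@^~ _) y0).
Qed.

(** Modulo the augmentation ideal I, phi is the identity.  Hence if x has
    coefficients in I, so has phi x, and phi (a x) = phi a * phi x = a * phi x
    since phi a - a has coefficients in I and I^2 = 0.  Taking a letter for a
    gives an induction on words. *)
Lemma unipotent_fix (R : comNzRingType) (dgR : int -> R -> Prop)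
    (B : augmented dgR) (phi : {lrmorphism series B -> series B}) :
  infinitesimal B ->
  (forall x, smap (aug_eps B) (phi x) = smap (aug_eps B) x) ->
  forall x, smap (aug_eps B) x = 0 -> phi x = x.
Proof.
move=> infB epsphi.
have phiM a x : smap (aug_eps B) x = 0 -> phi (a * x) = a * phi x.
  move=> x0; apply/eqP; rewrite (rmorphM phi) -subr_eq0 -mulrBl.
  by rewrite (infinitesimal_serM infB) ?smapB ?epsphi ?subrr.
have phiE x : smap (aug_eps B) x = 0 -> phi x = x [::] *: 1 +
    (tau B * phi (lshift [:: Tau] x) + te B * phi (lshift [:: Te] x)).
  move=> x0; rewrite {1}[x]ser_first_letter !rmorphD /= linearZ /= rmorph1.
  by congr (_ + (_ + _)); apply: phiM; apply/funext=> w;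
    apply: (congr1 (@^~ _) x0).
move=> x x0; apply/funext=> w; elim: w x x0 => [|a w IHw] x x0.
  rewrite phiE // !serDE serZE tauM_nil teM_nil !addr0.
  by rewrite [X in _ * X]/(1 : B) mulr1.
have x0a b : smap (aug_eps B) (lshift [:: b] x) = 0.
  by apply/funext=> v; apply: (congr1 (@^~ (b :: v)) x0).
rewrite phiE // !serDE serZE [X in _ * X]/(0 : B) mulr0 add0r.
rewrite tauM_cons teM_cons !IHw //.
by case: a; rewrite ?addr0 ?add0r.
Qed.

(** Comparing values at tau, an equivalence contributes on both sides only terms
    whose words contain the letter tau, and the coefficient of t^i does not see
    these.  The parameters are thus invariants of an infinitesimal deformation of
    the trivial structure. *)
Lemma moore_equiv_infinitesimal (R : comNzRingType) (dgR : int -> R -> Prop)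
    (d : int) (B : augmented dgR) (lam mu : nat -> B) :
  infinitesimal B ->
  (forall i, (0 < i)%N -> aug_eps B (lam i) = 0) ->
  (forall i, (0 < i)%N -> aug_eps B (mu i) = 0) ->
  def_equiv d (moore_der lam) (moore_der mu) ->
  forall i, (0 < i)%N -> lam i = mu i.
Proof.
move=> infB eps_lam eps_mu [phi [_ phim epsphi]] i i_gt0.
have tser0 v : (forall j, (0 < j)%N -> aug_eps B (v j) = 0) ->
    smap (aug_eps B) (tser v) = 0.
  move=> v0; rewrite smap_tser (@eq_tser _ _ (fun=> 0)) //.
  by apply/funext=> w; rewrite /tser if_same.
pose y := phi (tau B) - tau B.
have y0 : smap (aug_eps B) y = 0 by rewrite smapB epsphi subrr.
have phitau : phi (tau B) = tau B + y by rewrite addrC subrK.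
clearbody y; have := congr1 (@^~ (nseq i Te)) (phim (tau B)).
rewrite moore_der_tau rmorphD rmorphXn /= (unipotent_fix infB) ?tser0 // phitau.
have [mooreL _] := odd_derivation_moore mu.
have -> : moore_der mu (tau B + y) = moore_der mu (tau B) + moore_der mu y.
  by rewrite -{1}[tau B]scale1r mooreL scale1r.
have notau j : ~~ has is_tau (nseq j Te) by rewrite has_nseq andbF.
rewrite moore_der_tau [(tau B + y) ^+ 2]expr2 mulrDl !mulrDr.
rewrite (infinitesimal_serM infB y0 y0) addr0.
rewrite !serDE !(tauM_notau, Mtau_notau) // !addr0 !tser_nseq //.
(* It remains to see that m(mu) y has no terms in t alone. *)
rewrite expr2 tauM_notau // addr0 => ->; rewrite -[RHS]addr0; congr (_ + _).
rewrite /moore_der serBE serDE /ad_tau serBE tauM_notau // Mtau_notau //.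
rewrite subrr addr0 /odder !big1 ?subrr // => j _.
  (* The part - tau^2 d/dtau creates the letter tau. *)
  rewrite expr2 -mulrA serDE tauM_notau ?mul0r; last first.
    by rewrite drop_nseq.
  by rewrite addr0 mulr0.
(* The part (sum mu_i t^i) d/dtau multiplies elements of the square-zero ideal. *)
rewrite serDE (infinitesimal_serM infB) ?tser0 //; last first.
  by apply/funext=> w; apply: (congr1 (@^~ (_ ++ w)) y0).
by rewrite mul0r addr0 mulr0.
Qed.

(** The coefficient of t^i in the value at tau is the parameter lam_i on one
    side, and 0 for the trivial structure. *)
Lemma moore_deformation_eps (R : comNzRingType) (dgR : int -> R -> Prop)
    (B : augmented dgR) (lam : nat -> B) :
  (forall x, smap (aug_eps B) (moore_der lam x) =
     moore_der (fun=> 0) (smap (aug_eps B) x)) ->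
  forall i, (0 < i)%N -> aug_eps B (lam i) = 0.
Proof.
move=> defo i i_gt0; have := congr1 (@^~ (nseq i Te)) (defo (tau B)).
rewrite smap_moore smap_tau !moore_der_tau !serDE.
by rewrite !tser_nseq // => /addIr.
Qed.

Lemma def_equiv_refl (R : comNzRingType) (dgR : int -> R -> Prop) (d : int)
    (B : augmented dgR) (m1 m2 : series B -> series B) :
  m1 =1 m2 -> def_equiv d m1 m2.
Proof.
move=> eq_m; exists (idfun : {lrmorphism series B -> series B}).
split=> //; split=> //; first by exists id.
  by move=> n; exists n.
exists (fun=> 0), (fun i => (i == 1)%:R); split; last by exists 1; rewrite mulr1.
  rewrite -[LHS]addr0; congr (_ + _); apply/funext=> w.
  by rewrite /tser if_same.
by apply/funext=> -[|[] [|[] w]]; rewrite /tser //= if_same.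
Qed.

(** * Miniversality *)

Theorem theorem6p1 (R : comNzRingType) (dgR : int -> R -> Prop)
    (evR : even_grading dgR) (d : int) (ev_d : (2 %| d)%Z) :
  miniversal d (moore_der (fun _ : nat => 0 : R))
    (B := universal_base evR ev_d) (moore_der (upoly_var R)).
Proof.
set B0 := universal_base evR ev_d.
have epsU i : aug_eps B0 (upoly_var R i) = 0 by apply: upoly_var_eps.
split; [split|].
- split.
    exists (upoly_var R); split=> // i i_gt0.
    exact: (upoly_var_deg evR ev_d i_gt0).
  move=> x; rewrite smap_moore; congr (moore_der _ _).
  by apply/funext=> i; apply: epsU.
- move=> B mB [[lam [lam_deg mBE]] defo].
  have {}mBE : mB = moore_der lam by apply/funext.
  subst mB; have eps_lam := moore_deformation_eps defo.
  exists (upoly_eval lam : {lrmorphism B0 -> B}); split; first split.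
  + exact: upoly_eval_deg.
  + apply: (@upoly_rmorph_ext _ _ (aug_eps B \o upoly_eval lam) (aug_eps B0)).
      by move=> c /=; rewrite !linearZ !rmorph1.
    move=> i i_gt0; apply: etrans (esym (epsU i)).
    by rewrite /= upoly_eval_var // eps_lam.
  apply: def_equiv_refl => x; rewrite pushforward_moore /moore_der.
  congr (odder _ _ _ + _ - _); apply: eq_tser => i i_gt0.
  exact: upoly_eval_var.
- move=> B mB infB [[lam [_ mBE]] defo] f g [fhom feq] [ghom geq].
  have {}mBE : mB = moore_der lam by apply/funext.
  subst mB; have eps_lam := moore_deformation_eps defo.
  (* The push-forward along h has parameters h u_i, equivalent to lam. *)
  have fU (h : {lrmorphism B0 -> B}) : aug_hom h ->
      def_equiv d (pushforward h (moore_der (upoly_var R))) (moore_der lam) ->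
      forall i, (0 < i)%N -> h (upoly_var R i) = lam i.
    move=> [_ heps] hequiv; apply: (moore_equiv_infinitesimal infB _ eps_lam).
      by move=> i _; rewrite heps epsU.
    by rewrite -(funext (pushforward_moore _ _)); exact: hequiv.
  apply: upoly_rmorph_ext => [c|i i_gt0]; first by rewrite /= !linearZ !rmorph1.
  exact: etrans (fU f fhom feq i i_gt0) (esym (fU g ghom geq i i_gt0)).
Qed.
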